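(* Let $p$ be a prime and $n\ge0$. The conjugacy classes of $W_{B_n}$ whose elements have order $p^r$ for some $r\ge0$ are labelled by pairs of partitions (the lengths of the positive cycles and the lengths of the negative cycles) of total size $n$ as follows: if $p\ne2$, all cycles are positive and all their lengths are powers of $p$; if $p=2$, both positive and negative cycles are allowed and all their lengths are powers of $2$ (with possibly different exponents). Consequently $$\tilde r(2,W_{B_n}) = \sum_{m=0}^n \tilde r(2,S_m)\,\tilde r(2,S_{n-m}),$$ $$\tilde r(p,W_{B_n}) = \tilde r(p,S_n)\quad (p\ne2),$$ $$\widetilde{OGF}(2,B,x) = \widetilde{OGF}(2,A,x)\,\widetilde{OGF}(2,A,x),$$ $$OGF(p,B,x) = OGF(p,A,x)\quad(p\neq2).$$
   Context: For a finite group $G$ and a prime $p$, $r(p,G)$ is the number of conjugacy classes of $G$ whose elements have order $p^d$ for some $d \ge 1$, and $\tilde r(p,G) = r(p,G)+1$ (so $d=0$ is also allowed). $W_{B_n} = \mathbb{Z}/2\wr S_n$ is the Weyl group of type $B_n$ (equivalently $C_n$), i.e. the group of signed permutations of $n$ coordinates (trivial for $n=0$). Each signed permutation decomposes into signed cycles; a cycle is positive (resp. negative) if the product of its signs is $+1$ (resp. $-1$), and conjugacy classes of $W_{B_n}$ correspond to pairs of partitions of total size $n$ recording the lengths of positive and of negative cycles. Generating functions are formal power series: $OGF(p,A,x)=\sum_{n\ge0} r(p,S_n)x^n$, $\widetilde{OGF}(p,A,x)=\sum_{n\ge0}\tilde r(p,S_n)x^n$, and $OGF(p,B,x)$, $\widetilde{OGF}(p,B,x)$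 are defined likewise with $W_{B_n}$ in place of $S_n$. $S_0$ is the trivial group. *)

(* Defs.v *)
From HB Require Import structures.
From mathcomp Require Import all_boot all_order all_algebra all_fingroup.

Set Implicit Arguments.
Unset Strict Implicit.
Unset Printing Implicit Defensive.

Import GroupScope.

(* The bound on d loses nothing when p > 1, since d < p ^ d = #[x] <= #|G|;
   see ppow_orderP. *)
Definition ppow_order p (gT : finGroupType) (G : {group gT}) (x : gT) : bool :=
  [exists d : 'I_#|G|, (0 < d) && (#[x] == p ^ d)%N].

Lemma ppow_orderP p (gT : finGroupType) (G : {group gT}) (x : gT) :
  prime p -> x \in G ->
  reflect (exists2 d, 0 < d & #[x] = (p ^ d)%N) (ppow_order p G x).
Proof.
move=> pr_p Gx; apply: (iffP existsP) => [[d /andP[d0 /eqP xd]]|[d d0 xd]].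
  by exists d.
have ltdG : d < #|G|.
  apply: leq_trans (ltn_expl d (prime_gt1 pr_p)) _.
  by rewrite -xd subset_leq_card // cycle_subG.
by exists (Ordinal ltdG); rewrite d0 xd eqxx.
Qed.

Definition r p (gT : finGroupType) (G : {group gT}) : nat :=
  #|[set x ^: G | x in G & ppow_order p G x]|.

Definition r_tilde p (gT : finGroupType) (G : {group gT}) : nat := (r p G).+1.

(* The signed permutation w sends the basis vector e_i to
   (-1)^(sp_sign w i) e_(sp_perm w i).  As for permutations in the library,
   u * v means u first, then v. *)
Record signed_perm n := SignedPerm {
  sp_perm : 'S_n;
  sp_sign : {ffun 'I_n -> bool} }.

Section SignedPermGroup.
Variable n : nat.
Implicit Types u v w : signed_perm n.

Definition sp_code w := (sp_perm w, sp_sign w).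
Definition sp_decode (c : 'S_n * {ffun 'I_n -> bool}) := SignedPerm c.1 c.2.
Lemma sp_codeK : cancel sp_code sp_decode. Proof. by case. Qed.

HB.instance Definition _ := Finite.copy (signed_perm n) (can_type sp_codeK).

Definition sp_one : signed_perm n := SignedPerm 1 [ffun=> false].
Definition sp_mul u v := SignedPerm (sp_perm u * sp_perm v)
  [ffun i => sp_sign u i (+) sp_sign v (sp_perm u i)].
Definition sp_inv u := SignedPerm (sp_perm u)^-1
  [ffun i => sp_sign u ((sp_perm u)^-1 i)].

Lemma sp_mulA : associative sp_mul.
Proof.
move=> u v w; congr SignedPerm; first by rewrite /= mulgA.
by apply/ffunP => i; rewrite !ffunE /= permM addbA.
Qed.

Lemma sp_mul1 : left_id sp_one sp_mul.
Proof.
case=> s e; congr SignedPerm; first by rewrite /= mul1g.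
by apply/ffunP => i; rewrite !ffunE /= perm1.
Qed.

Lemma sp_mulV : left_inverse sp_one sp_inv sp_mul.
Proof.
move=> u; congr SignedPerm; first by rewrite /= mulVg.
by apply/ffunP => i; rewrite !ffunE /= addbb.
Qed.

HB.instance Definition _ :=
  Finite_isGroup.Build (signed_perm n) sp_mulA sp_mul1 sp_mulV.

End SignedPermGroup.

Definition WB n : {group signed_perm n} := [set: signed_perm n]%G.

Definition cycle_sign n (w : signed_perm n) (C : {set 'I_n}) : int :=
  (\prod_(i in C) (-1) ^+ sp_sign w i)%R.

(* Fixed points count as cycles of length 1. *)
Definition cycle_lengths n (w : signed_perm n) (s : int) : seq nat :=
  sort geq
    [seq #|C| | C : {set 'I_n} <- enum (porbits (sp_perm w))
              & cycle_sign w C == s].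

Definition cycle_types n (w : signed_perm n) : seq nat * seq nat :=
  (cycle_lengths w 1%R, cycle_lengths w (-1)%R).

Definition is_partition (l : seq nat) : bool := sorted geq l && (0 \notin l).

Definition parts_powers p (l : seq nat) : Prop :=
  forall k, k \in l -> exists a, k = (p ^ a)%N.

Definition ppow_label p n (lm : seq nat * seq nat) : Prop :=
  [/\ is_partition lm.1, is_partition lm.2, (sumn lm.1 + sumn lm.2 = n)%N,
      parts_powers p lm.1
    & if p == 2 then parts_powers p lm.2 else lm.2 = [::]].

(* Formal power series over R, as coefficient sequences compared by =1. *)
Definition fps (R : Type) := nat -> R.

Definition fps_mul (R : pzSemiRingType) (f g : fps R) : fps R :=
  fun n => (\sum_(m < n.+1) f m * g (n - m)%N)%R.

Definition OGF_A p : fps int := fun n => (r p [set: 'S_n])%:Z%R.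
Definition OGFt_A p : fps int := fun n => (r_tilde p [set: 'S_n])%:Z%R.
Definition OGF_B p : fps int := fun n => (r p (WB n))%:Z%R.
Definition OGFt_B p : fps int := fun n => (r_tilde p (WB n))%:Z%R.

(* Main.v *)
Require Import Defs.
From mathcomp Require Import all_boot all_order all_algebra all_fingroup.
From mathcomp Require Import cyclic.

(** A signed permutation [w] is determined up to conjugacy by the multiset of
    pairs (length, parity) of its cycles, the parity of a cycle being the sum
    modulo 2 of its signs ([cycle_data], [class_cycle_types]), and every
    multiset with positive lengths of sum [n] occurs ([cycle_data_surj]).  All
    that is needed about powers of [w] follows from one computation: if [i]
    lies on a cycle of length [c], then [w ^+ c] fixes [i] up to the parity of that cycle, hence
    [w ^+ (m * c)] fixes [i] up to [m] times that parity ([sp_sign_mul]).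

    Consequently [w ^+ (p ^ a)] is trivial exactly when each length [c] divides
    [p ^ a] and the quotient kills the parity.  For [p] odd the quotient is odd,
    so all cycles must be positive; for [p = 2] enlarging [a] by one makes the
    quotient even, so the parity is free ([ppow_order_cycles]).

    To count classes, the numbers for the symmetric group are read off from the
    same classification: unsigned permutations sit inside signed ones as the
    elements with trivial signs, two of them are conjugate in one group if and
    only if they are conjugate in the other, and their labels are those with
    empty negative part.  Hence the class count of the symmetric group is the
    number of partitions into powers of [p] ([r_tilde_Sym]).  For [p] odd these
    are all the labels ([r_tilde_WB_odd]); for [p = 2] a label of total size [n]
    is a partition of some [m <= n] together with a partition of [n - m]
    ([r_tilde_WB2]).  The identities of power series compare coefficients. *)

Set Implicit Arguments.
Unset Strict Implicit.
Unset Printing Implicit Defensive.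

Import GroupScope.

(** * Powers of a permutation along a cycle *)

Section PermutationCycles.
Variables (T : finType) (s : {perm T}).

Lemma card_porbit_gt0 x : 0 < #|porbit s x|.
Proof. by rewrite lt0n card_porbit_neq0. Qed.

Lemma permX_porbit_mul x m : (s ^+ (m * #|porbit s x|)%N) x = x.
Proof.
elim: m => [|m IHm]; first by rewrite perm1.
by rewrite mulSn expgD permM (permX s x) iter_porbit IHm.
Qed.

Lemma permX_porbit_mod x j : (s ^+ j) x = (s ^+ (j %% #|porbit s x|)) x.
Proof. by rewrite {1}(divn_eq j #|porbit s x|) expgD permM permX_porbit_mul. Qed.

Lemma eq_permX_porbit x j k :
  ((s ^+ j) x == (s ^+ k) x) = (j == k %[mod #|porbit s x|]).
Proof.
have nthE m : (s ^+ m) x =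
    nth x (traject s x #|porbit s x|) (m %% #|porbit s x|).
  by rewrite nth_traject ?ltn_pmod ?card_porbit_gt0 // -permX -permX_porbit_mod.
by rewrite !nthE nth_uniq ?uniq_traject_porbit ?size_traject
  ?ltn_pmod ?card_porbit_gt0.
Qed.

Lemma partition_porbits : partition (porbits s) [set: T].
Proof.
have -> : porbits s = preim_partition (porbit s) setT.
  apply/setP=> C; apply/imsetP/imsetP => -[x _ ->]; exists x => //;
    by apply/setP=> y; rewrite !inE /= eq_porbit_mem porbit_sym.
exact: preim_partitionP.
Qed.

End PermutationCycles.

(** * Powers of a signed permutation and its order *)

Section SignedCycles.
Variable n : nat.
Implicit Types (w u v : signed_perm n) (C : {set 'I_n}).

(** The additive form of the sign of a cycle: parities in [bool] make the signs
    of powers a plain computation with [addb]. *)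
Definition cycle_parity w C : bool := \big[addb/false]_(i in C) sp_sign w i.

Lemma cycle_signE w C : cycle_sign w C = ((-1) ^+ cycle_parity w C)%R.
Proof.
rewrite /cycle_sign /cycle_parity.
elim/big_rec2: _ => // i b x _ ->.
by case: (sp_sign w i) b => [] [].
Qed.

Lemma sp_permX w k : sp_perm (w ^+ k) = sp_perm w ^+ k.
Proof. by elim: k => // k IHk; rewrite !expgS /= IHk. Qed.

Lemma sp_signD w j k i : sp_sign (w ^+ (j + k)%N) i =
  sp_sign (w ^+ j) i (+) sp_sign (w ^+ k) ((sp_perm w ^+ j) i).
Proof. by rewrite expgD /= ffunE sp_permX. Qed.

Lemma sp_signX w k i : sp_sign (w ^+ k) i =
  \big[addb/false]_(x <- traject (sp_perm w) i k) sp_sign w x.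
Proof.
elim: k i => [|k IHk] i; first by rewrite big_nil /= ffunE.
by rewrite expgS /= ffunE IHk big_cons.
Qed.

(** Going once around a cycle meets each of its signs exactly once. *)
Lemma sp_sign_porbit w i :
  sp_sign (w ^+ #|porbit (sp_perm w) i|) i = cycle_parity w (porbit (sp_perm w) i).
Proof.
rewrite sp_signX /cycle_parity big_uniq ?uniq_traject_porbit //=.
by apply: eq_bigl => x; rewrite porbit_traject.
Qed.

Lemma sp_sign_mul w m i : sp_sign (w ^+ (m * #|porbit (sp_perm w) i|)%N) i =
  odd m && cycle_parity w (porbit (sp_perm w) i).
Proof.
elim: m => [|m IHm]; first by rewrite mul0n /= ffunE.
rewrite mulSn sp_signD sp_sign_porbit permX iter_porbit IHm /=.
by case: (odd m); case: cycle_parity.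
Qed.

Lemma signed_permP u v :
  (forall i, sp_perm u i = sp_perm v i) ->
  (forall i, sp_sign u i = sp_sign v i) -> u = v.
Proof.
case: u => s e; case: v => t f /= st ef.
by congr SignedPerm; [apply/permP | apply/ffunP].
Qed.

Lemma ppow_order_expg p (gT : finGroupType) (x : gT) : prime p ->
  (exists a, #[x] = (p ^ a)%N) <-> (exists a, x ^+ (p ^ a)%N = 1).
Proof.
move=> pr_p; split=> -[a]; first by move=> xa; exists a; rewrite -xa expg_order.
by move/eqP; rewrite -order_dvdn => /(dvdn_pfactor _ _ pr_p)[b _ ->]; exists b.
Qed.

(** The exponent in [w ^+ (p ^ a) = 1] gives on each cycle of length [c] the two
    conditions [c %| p ^ a] and [odd (p ^ a %/ c) && parity = false].
    Conversely the lengths are at most [n], so they divide [p ^ n], and the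
    exponent [p ^ n.+1] has one more factor [p], which for [p = 2] annihilates
    the parities. *)
Lemma ppow_order_cycles p w : prime p ->
  (exists a, #[w] = (p ^ a)%N) <->
  (forall i, (exists a, #|porbit (sp_perm w) i| = (p ^ a)%N) /\
     (p <> 2 -> ~~ cycle_parity w (porbit (sp_perm w) i))).
Proof.
move=> pr_p; apply: iff_trans (ppow_order_expg _ pr_p) _; split=> [[a wa1] i | cyc].
  set c := #|_|.
  have c_dv : c %| p ^ a.
    rewrite /dvdn -(mod0n c) -eq_permX_porbit -sp_permX wa1 /=.
    by rewrite expg0.
  have /(dvdn_pfactor _ _ pr_p)[b _ cb] := c_dv.
  split=> [|p_neq2]; first by exists b.
  have odd_p : odd p by case: (even_prime pr_p).
  have := sp_sign_mul w (p ^ a %/ c) i; rewrite divnK // wa1 /= ffunE.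
  have -> : odd (p ^ a %/ c).
    by apply: dvdn_odd (_ : odd (p ^ a)); rewrite ?oddX ?odd_p ?orbT ?dvdn_div.
  by move=> /= <-.
have dvd_c i : #|porbit (sp_perm w) i| %| p ^ n.
  have [[a ca] _] := cyc i; rewrite ca dvdn_exp2l //.
  apply: leq_trans (ltnW (ltn_expl a (prime_gt1 pr_p))) _.
  by rewrite -ca -[X in _ <= X]card_ord max_card.
exists n.+1; have mulE i : (p ^ n.+1)%N =
    (p * (p ^ n %/ #|porbit (sp_perm w) i|) * #|porbit (sp_perm w) i|)%N.
  by rewrite -mulnA divnK // expnS.
apply: signed_permP => i; first by rewrite sp_permX (mulE i) permX_porbit_mul perm1.
rewrite (mulE i) sp_sign_mul ffunE.
have [->|/eqP p_neq2] := eqVneq p 2; first by rewrite oddM.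
by have [_ /(_ p_neq2)/negPf->] := cyc i; rewrite andbF.
Qed.

End SignedCycles.

(** * Cycle types and cycle data *)

Section CycleData.

Definition lengths_of (b : bool) (cs : seq (nat * bool)) : seq nat :=
  sort geq [seq c.1 | c <- cs & c.2 == b].

Definition types_of cs := (lengths_of false cs, lengths_of true cs).

Lemma mem_lengths_of b cs l : (l \in lengths_of b cs) = ((l, b) \in cs).
Proof.
rewrite mem_sort; apply/mapP/idP => [[[k c]]|lb_cs].
  by rewrite mem_filter => /andP[/eqP/= -> kb_cs ->].
by exists (l, b); rewrite // mem_filter eqxx.
Qed.

Lemma geq_total : total geq. Proof. by move=> a b; apply: leq_total. Qed.
Lemma geq_trans : transitive geq.
Proof. by move=> a b c ba ac; apply: leq_trans ac ba. Qed.
Lemma geq_anti : antisymmetric geq.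
Proof. by move=> a b; rewrite andbC => /anti_leq. Qed.

Lemma sumn_lengths_of cs :
  (sumn (lengths_of false cs) + sumn (lengths_of true cs))%N =
    sumn [seq c.1 | c <- cs].
Proof.
rewrite !(perm_sumn (permEl (perm_sort _ _))).
by elim: cs => // -[l []] cs /= <-; [apply: addnCA | rewrite addnA].
Qed.

(** Sorting only normalizes the order of the cycles: the multiplicity of [l] in
    the list of sign [b] is the multiplicity of the pair [(l, b)]. *)
Lemma types_of_perm cs ds : types_of cs = types_of ds <-> perm_eq cs ds.
Proof.
have sortP := perm_sortP geq_total geq_trans geq_anti.
split=> [[/sortP cds0 /sortP cds1] | cds]; last first.
  by congr pair; apply/sortP/perm_map/perm_filter.
have countE b es l :
    count_mem l [seq c.1 | c <- es & c.2 == b] = count_mem (l, b) es.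
  rewrite count_map count_filter; apply: eq_count => -[k c] /=.
  by rewrite -pair_eqE.
rewrite /perm_eq; apply/allP => -[l b] _ /=; apply/eqP.
by rewrite -!countE; case: b; [move/seq.permP: cds1 => -> | move/seq.permP: cds0 => ->].
Qed.

(** Translates the two conditions on the lists of a label into one condition per
    cycle, the form produced by [ppow_order_cycles]. *)
Lemma ppow_label_types_of p n cs : prime p ->
  ppow_label p n (types_of cs) <->
  sumn [seq c.1 | c <- cs] = n /\
  (forall c, c \in cs -> (exists a, c.1 = (p ^ a)%N) /\ (p <> 2 -> ~~ c.2)).
Proof.
move=> pr_p; rewrite -sumn_lengths_of; split.
  case=> _ _ /= -> pow0; case: eqP => [p2|p_neq2] pow1; split=> // -[l []];
    rewrite -mem_lengths_of => lcs /=.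
  - by split=> //; apply: pow1.
  - by split=> //; apply: pow0.
  - by rewrite pow1 in lcs.
  - by split=> //; apply: pow0.
case=> sum_n cyc; have pow b : parts_powers p (lengths_of b cs).
  by move=> l; rewrite mem_lengths_of => /cyc[].
have part b : is_partition (lengths_of b cs).
  rewrite /is_partition sort_sorted; last exact: geq_total.
  apply/negP=> /pow[a] /esym/eqP; rewrite expn_eq0.
  by rewrite -[p == 0](negbK) -lt0n prime_gt0.
split=> //=; case: eqP => [//|p_neq2].
case E: (lengths_of true cs) => [//|l ls].
have: l \in lengths_of true cs by rewrite E mem_head.
by rewrite mem_lengths_of => /cyc[_ /(_ p_neq2)].
Qed.

Lemma types_of_label (lm : seq nat * seq nat) :
  is_partition lm.1 -> is_partition lm.2 ->
  types_of ([seq (l, false) | l <- lm.1] ++ [seq (l, true) | l <- lm.2]) = lm.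
Proof.
case: lm => l m /= /andP[l_sort _] /andP[m_sort _].
have filtE b c (k : seq nat) : [seq d.1 | d <- [seq (x, b) | x <- k] & d.2 == c]
    = if b == c then k else [::].
  by rewrite filter_map; case: eqP => [->|/eqP/negPf bc];
    elim: k => //= x k IHk; rewrite ?eqxx ?bc //= IHk.
rewrite /types_of /lengths_of !filter_cat !map_cat !filtE /= cats0.
by rewrite !sorted_sort //; apply: geq_trans.
Qed.

Variable n : nat.
Implicit Types (w u v : signed_perm n).

Definition cycle_data w : seq (nat * bool) :=
  [seq (#|C|, cycle_parity w C) | C : {set 'I_n} <- enum (porbits (sp_perm w))].

Lemma cycle_typesE w : cycle_types w = types_of (cycle_data w).
Proof.
by congr pair; rewrite /cycle_lengths /lengths_of filter_map -map_comp;
  congr sort; congr map; apply: eq_filter => C; rewrite cycle_signE /=;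
  case: cycle_parity.
Qed.

Lemma sumn_cycle_data w : sumn [seq c.1 | c <- cycle_data w] = n.
Proof.
rewrite -map_comp sumnE big_map big_enum /=.
by rewrite -(card_partition (partition_porbits _)) cardsT card_ord.
Qed.

Lemma ppow_order_label p w : prime p ->
  (exists a, #[w] = (p ^ a)%N) <-> ppow_label p n (cycle_types w).
Proof.
move=> pr_p; rewrite cycle_typesE.
apply: iff_trans (ppow_order_cycles _ pr_p) _.
apply: iff_trans (iff_sym (ppow_label_types_of _ _ pr_p)).
split=> [cyc | [_ cyc] i].
  split=> [|_ /mapP[C C_w ->]]; first exact: sumn_cycle_data.
  by move: C_w; rewrite mem_enum => /imsetP[i _ ->]; apply: cyc.
apply: (cyc (#|porbit _ i|, cycle_parity w (porbit _ i))).
by apply: map_f; rewrite mem_enum imset_f.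
Qed.

End CycleData.

(** * Conjugacy of signed permutations *)

(** Pairs off the cycles of two elements with equal cycle data.  The value is an
    option so that no default element of [U] is required. *)
Lemma perm_map_matching (S U K : eqType) (f : S -> K) (g : U -> K)
    (xs : seq S) (ys : seq U) :
  uniq xs -> uniq ys -> perm_eq (map f xs) (map g ys) ->
  exists phi : S -> option U,
    (forall x, x \in xs -> exists y, [/\ phi x = Some y, y \in ys & g y = f x]) /\
    {in xs &, injective phi}.
Proof.
elim: xs ys => [|x xs IHxs] ys /=; first by exists (fun=> None); split.
move=> /andP[x_xs uniq_xs] uniq_ys pfg.
have /mapP[y y_ys fx] : f x \in map g ys.
  by rewrite -(perm_mem pfg) mem_head.
have pfg' : perm_eq (map f xs) (map g (rem y ys)).
  rewrite -(perm_cons (f x)); apply: (perm_trans pfg).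
  by rewrite fx -map_cons perm_map // perm_to_rem.
have [phi [phiP phi_inj]] := IHxs _ uniq_xs (rem_uniq y uniq_ys) pfg'.
have phi_neq z : z \in xs -> Some y <> phi z.
  move=> /phiP[y' [-> + _]] => + [yy'].
  by rewrite -yy' mem_rem_uniq // inE eqxx.
exists (fun z => if z == x then Some y else phi z); split=> [z|z z'].
  rewrite inE; case: eqP => [-> _ | _ /= /phiP[y' [-> y'_ys gy']]].
    by exists y.
  by exists y'; split=> //; apply: mem_rem y'_ys.
rewrite !inE; case: eqP => [->|_] /=; case: eqP => [->|_] //=.
- by move=> _ /phi_neq.
- by move=> /phi_neq + _ => /nesym.
- exact: phi_inj.
Qed.

Section Conjugacy.
Variable n : nat.
Implicit Types (w u v g : signed_perm n).

(** A conjugator [g] carries the cycle of [i] under [u] onto the cycle of [g i]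
    under [v].  The parity is preserved because [u ^+ c] and [v ^+ c], for the
    common length [c], are also intertwined by [g]: both sides then contain the
    sign of [g] at [i], which cancels. *)
Lemma conj_cycle_data u v g : u * g = g * v -> perm_eq (cycle_data u) (cycle_data v).
Proof.
move=> ug; have uXg k : u ^+ k * g = g * v ^+ k.
  elim: k => [|k IHk]; first by rewrite !expg0 mulg1 mul1g.
  by rewrite !expgS -mulgA IHk !mulgA ug.
have permXg k i : sp_perm g ((sp_perm u ^+ k) i) = (sp_perm v ^+ k) (sp_perm g i).
  by have /(congr1 (fun w => sp_perm w i)) := uXg k; rewrite /= !permM !sp_permX.
have porbit_g i :
    porbit (sp_perm v) (sp_perm g i) = sp_perm g @: porbit (sp_perm u) i.
  apply/setP=> x; apply/porbitP/imsetP => [[k ->]|[_ /porbitP[k ->] ->]].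
    by exists ((sp_perm u ^+ k) i); rewrite ?mem_porbit ?permXg.
  by exists k; rewrite permXg.
have parity_g i : cycle_parity v (porbit (sp_perm v) (sp_perm g i)) =
    cycle_parity u (porbit (sp_perm u) i).
  have := congr1 (fun w => sp_sign w i) (uXg #|porbit (sp_perm u) i|).
  rewrite /= !ffunE sp_permX permX iter_porbit sp_sign_porbit.
  rewrite -(card_imset _ (@perm_inj _ (sp_perm g))) -porbit_g sp_sign_porbit.
  by rewrite addbC => /addbI.
have orbitsE : perm_eq (enum (porbits (sp_perm v)))
    [seq sp_perm g @: C | C : {set 'I_n} <- enum (porbits (sp_perm u))].
  apply: uniq_perm; first exact: enum_uniq.
    by rewrite map_inj_uniq ?enum_uniq //; apply/imset_inj/perm_inj.
  move=> C; rewrite mem_enum; apply/imsetP/mapP => [[i _ ->]|[D]].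
    exists (porbit (sp_perm u) ((sp_perm g)^-1 i)).
      by rewrite mem_enum imset_f.
    by rewrite -porbit_g permKV.
  rewrite mem_enum => /imsetP[i _ ->] ->.
  by exists (sp_perm g i); rewrite // porbit_g.
rewrite perm_sym; apply: perm_trans (perm_map _ orbitsE) _; rewrite -map_comp.
apply: etrans (perm_refl (cycle_data u)); congr perm_eq.
apply/eq_in_map => C; rewrite mem_enum => /imsetP[i _ ->] /=.
by rewrite card_imset ?parity_g -?porbit_g ?parity_g //; apply: perm_inj.
Qed.

Lemma sp_sign_mod w i c j :
  c = #|porbit (sp_perm w) i| ->
  sp_sign (w ^+ j) i =
    (odd (j %/ c) && cycle_parity w (porbit (sp_perm w) i))
      (+) sp_sign (w ^+ (j %% c)) i.
Proof.
move=> ->; rewrite {1}(divn_eq j #|porbit (sp_perm w) i|) sp_signD.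
by rewrite sp_sign_mul permX_porbit_mul.
Qed.

(** Match the cycles of [u] with cycles of [v] of the same length and parity,
    and fix a base point [x] on each cycle of [u] and [y] on its partner.  The
    conjugator is forced once it sends [x] to [y] with sign [+1]: it must send
    [u ^+ m] applied to [x] to [v ^+ m] applied to [y], signs included.  This
    does not depend on the choice of [m]: modulo the common length the
    permutations agree, and each full turn changes the two signs by the same
    parity. *)
Lemma sp_conj_of_cycle_data u v :
  perm_eq (cycle_data u) (cycle_data v) -> exists g, u * g = g * v.
Proof.
set s := sp_perm u; set t := sp_perm v => uv.
have [phi [phiP phi_inj]] :=
  perm_map_matching (enum_uniq _) (enum_uniq _) uv.
pose pt (C : {set 'I_n}) i := odflt i [pick j in C].
have ptP i (C : {set 'I_n}) k : k \in C -> pt C i \in C /\ pt C i = pt C k.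
  by rewrite /pt => Ck; case: pickP => // /(_ k); rewrite Ck.
pose x i := pt (porbit s i) i.
pose y i := pt (odflt set0 (phi (porbit s i))) i.
have orb_s i : porbit s i \in enum (porbits s) by rewrite mem_enum imset_f.
have x_orb i : porbit s (x i) = porbit s i.
  by apply/eqP; rewrite eq_porbit_mem; have [] := ptP i _ _ (porbit_id s i).
have y_orb i : [/\ phi (porbit s i) = Some (porbit t (y i)),
    #|porbit t (y i)| = #|porbit s (x i)|
  & cycle_parity v (porbit t (y i)) = cycle_parity u (porbit s (x i))].
  have [D [phiD + [cardD parD]]] := phiP _ (orb_s i).
  rewrite mem_enum => /imsetP[k _ defD]; rewrite x_orb -cardD -parD.
  suff -> : porbit t (y i) = D by [].
  apply/eqP; rewrite defD eq_porbit_mem /y phiD defD /=.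
  by have [] := ptP i _ _ (porbit_id t k).
have xy_s i : x (s i) = x i /\ y (s i) = y i.
  have si : porbit s (s i) = porbit s i by have := porbit_perm s 1 i; rewrite expg1.
  rewrite /x /y si; split.
    by have [_ ->] := ptP (s i) _ _ (porbit_id s i).
  have [-> _ _] := y_orb i => /=.
  have [_ ->] := ptP (s i) _ _ (porbit_id t (y i)).
  by have [_ ->] := ptP i _ _ (porbit_id t (y i)).
pose hg_at i m :=
  ((t ^+ m) (y i), sp_sign (u ^+ m) (x i) (+) sp_sign (v ^+ m) (y i)).
have /fin_all_exists[hg hgP] i :
    exists hg_i, forall m, i = (s ^+ m) (x i) -> hg_i = hg_at i m.
  have [_ y_card y_par] := y_orb i.
  have /porbitP[m im] : i \in porbit s (x i) by rewrite x_orb porbit_id.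
  exists (hg_at i m) => k; rewrite {1}im => /eqP; rewrite eq_permX_porbit => /eqP mk.
  set c := #|porbit s (x i)| in mk y_card.
  have formE j : hg_at i j = hg_at i (j %% c).
    rewrite /hg_at permX_porbit_mod y_card (@sp_sign_mod u _ c) //.
    rewrite (@sp_sign_mod v _ c) // y_par.
    by rewrite addbACA addbb.
  by rewrite formE mk -formE.
have ex_m i : exists m, i = (s ^+ m) (x i).
  by apply/porbitP; rewrite x_orb porbit_id.
(* The cycle of y determines that of x, and m modulo the length is the position
   on either cycle. *)
have h_inj : injective (fun i => (hg i).1).
  move=> i k; have [m im] := ex_m i; have [m' km'] := ex_m k.
  rewrite (hgP i m im) (hgP k m' km') /hg_at /= => tik.
  have oo : porbit t (y i) = porbit t (y k).
    by rewrite -(porbit_perm t m) tik porbit_perm.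
  have sik : porbit s i = porbit s k.
    apply: phi_inj (orb_s i) (orb_s k) _.
    by have [-> _ _] := y_orb i; have [-> _ _] := y_orb k; rewrite oo.
  have xik : x i = x k.
    by rewrite /x sik; have [_ ->] := ptP i _ _ (porbit_id s k).
  have yik : y i = y k.
    rewrite /y sik; have [-> _ _] := y_orb k => /=.
    have [_ ->] := ptP i _ _ (porbit_id t (y k)).
    by have [_ ->] := ptP k _ _ (porbit_id t (y k)).
  rewrite im km' xik; apply/eqP; rewrite eq_permX_porbit.
  have [_ <- _] := y_orb k; rewrite -eq_permX_porbit.
  by rewrite -[in X in X == _]yik tik.
exists (SignedPerm (perm h_inj) [ffun i => (hg i).2]).
have hg_s i : hg (s i) = (t (hg i).1,
    sp_sign u i (+) (hg i).2 (+) sp_sign v (hg i).1).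
  have [m im] := ex_m i; have [xs ys] := xy_s i.
  have sim : s i = (s ^+ m.+1) (x (s i)) by rewrite xs expgSr permM -im.
  rewrite (hgP _ _ sim) (hgP _ _ im) /hg_at xs ys expgSr permM /=.
  rewrite -[m.+1]addn1 !sp_signD !expg1 -/s -/t -im.
  by congr pair; rewrite -!addbA; do 4![case: (sp_sign _ _)].
apply: signed_permP => i.
  by rewrite /= !permM !permE hg_s.
rewrite /= !ffunE permE -/s hg_s /=.
by do 2![case: (sp_sign _ _)]; case: (hg i).2.
Qed.

Lemma class_cycle_types u v :
  u ^: WB n = v ^: WB n <-> cycle_types u = cycle_types v.
Proof.
rewrite !cycle_typesE; apply: iff_trans (iff_sym (types_of_perm _ _)).
split=> [/class_eqP/imsetP[g _ ->]|/sp_conj_of_cycle_data[g ug]].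
  rewrite perm_sym; apply: (@conj_cycle_data _ _ g).
  by rewrite conjgE !mulgA mulgV mul1g.
apply/esym/class_eqP/imsetP; exists g; first by rewrite inE.
by rewrite conjgE ug mulKg.
Qed.

End Conjugacy.

(** * A signed permutation with prescribed cycles *)

Section Realization.

Lemma iter_ordS m (k : nat) (j : 'I_m) : val (iter k (@ordS m) j) = ((j + k) %% m)%N.
Proof.
elim: k => [|k IHk] /=; first by rewrite addn0 modn_small.
by rewrite IHk -addn1 modnDml addn1 addnS.
Qed.

(** The model rotates each block of the disjoint union of the ['I_(l i)] and is
    transported to ['I_n] by the enumeration [f].  The parity [e i] is put on
    the first point of the block alone, so it is the sum over the block. *)
Variables (I : finType) (l : I -> nat) (e : I -> bool) (n : nat).
Hypotheses (l_gt0 : forall i, 0 < l i) (sum_l : (\sum_i l i)%N = n).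

Let T := {i : I & 'I_(l i)}.

Lemma card_model : #|{: T}| = n.
Proof.
by rewrite card_tagged sumnE big_map big_enum -sum_l; apply: eq_bigr => i _;
  rewrite card_ord.
Qed.

Let f (t : T) : 'I_n := cast_ord card_model (enum_rank t).
Let f' (x : 'I_n) : T := enum_val (cast_ord (esym card_model) x).
Let fK : cancel f f'. Proof. by move=> t; rewrite /f /f' cast_ordK enum_rankK. Qed.
Let f'K : cancel f' f. Proof. by move=> x; rewrite /f /f' enum_valK cast_ordKV. Qed.

Let step (t : T) : T := Tagged (fun i => 'I_(l i)) (ordS (tagged t)).

Let step_inj : injective step.
Proof.
move=> [i j] [i' j'] /eqP; rewrite -tag_eqE /tag_eq /= => /andP[/eqP ii'].
by move: j'; rewrite -ii' => j'; rewrite tagged_asE => /eqP/ordS_inj->.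
Qed.

Let sigma_inj : injective (fun x => f (step (f' x))).
Proof. by move=> x y /(can_inj fK)/step_inj/(can_inj f'K). Qed.

Definition cycle_model : signed_perm n := SignedPerm (perm sigma_inj)
  [ffun x => e (tag (f' x)) && (val (tagged (f' x)) == 0%N)].

Let block (i : I) : {set 'I_n} := [set x | tag (f' x) == i].

Let sigmaX k (i : I) (j : 'I_(l i)) :
  (sp_perm cycle_model ^+ k) (f (Tagged _ j)) = f (Tagged _ (iter k (@ordS _) j)).
Proof.
elim: k => [|k IHk]; first by rewrite perm1.
by rewrite expgSr permM IHk permE fK.
Qed.

Let blockE i : block i = [set f (Tagged (fun i => 'I_(l i)) j) | j : 'I_(l i)].
Proof.
apply/setP=> x; rewrite inE; apply/eqP/imsetP => [|[j _ ->]]; last by rewrite fK.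
case Ex: (f' x) => [k j] /= ki; subst k; exists j => //.
by rewrite -[LHS]f'K Ex.
Qed.

Let tag_inj i : injective (fun j : 'I_(l i) => f (Tagged (fun i => 'I_(l i)) j)).
Proof. by move=> j j' /(can_inj fK)/eqP; rewrite eq_Tagged => /eqP. Qed.

Let porbit_block x : porbit (sp_perm cycle_model) x = block (tag (f' x)).
Proof.
case Ex: (f' x) => [i j] /=; rewrite -[x]f'K Ex blockE.
apply/setP=> y; apply/porbitP/imsetP => [[k ->]|[j' _ ->]].
  by exists (iter k (@ordS _) j); rewrite ?sigmaX.
  (* Rotate from j up to the end of the block, that is to 0, then on to j'. *)
  exists (l i - j + j')%N; rewrite sigmaX; congr (f (Tagged _ _)).
apply: val_inj; rewrite iter_ordS addnA subnKC ?modnDl ?modn_small //.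
exact: ltnW.
Qed.

Let card_block i : #|block i| = l i.
Proof. by rewrite blockE (card_imset _ (@tag_inj i)) card_ord. Qed.

Let parity_block i : cycle_parity cycle_model (block i) = e i.
Proof.
rewrite /cycle_parity blockE big_imset => [|j j' _ _ /tag_inj//].
rewrite (bigD1 (Ordinal (l_gt0 i))) //= big1 => [|j j_neq0].
  by rewrite ffunE fK eqxx andbT addbF.
by rewrite ffunE fK /=; case: (e i) => //; apply: negbTE.
Qed.

Lemma cycle_data_model :
  perm_eq (cycle_data cycle_model) [seq (l i, e i) | i <- enum I].
Proof.
have block_inj : injective block.
  move=> i i' /setP/(_ (f (Tagged _ (Ordinal (l_gt0 i))))).
  by rewrite !inE fK /= eqxx => /esym/eqP.
have orbE : perm_eq (enum (porbits (sp_perm cycle_model))) (map block (enum I)).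
  apply: uniq_perm; first exact: enum_uniq.
    by rewrite map_inj_uniq // enum_uniq.
  move=> C; rewrite mem_enum; apply/imsetP/mapP => [[x _ ->]|[i _ ->]].
    by exists (tag (f' x)); rewrite ?mem_enum ?porbit_block.
  exists (f (Tagged _ (Ordinal (l_gt0 i)))) => //.
  by rewrite porbit_block fK.
apply: perm_trans (perm_map _ orbE) _; rewrite -map_comp.
apply: etrans (perm_refl [seq (l i, e i) | i <- enum I]); congr perm_eq.
by apply: eq_map => i /=; rewrite card_block parity_block.
Qed.

End Realization.

Lemma cycle_data_surj n (cs : seq (nat * bool)) :
  (forall c, c \in cs -> 0 < c.1) -> sumn [seq c.1 | c <- cs] = n ->
  exists w : signed_perm n, perm_eq (cycle_data w) cs.
Proof.
move=> cs_gt0 sum_cs; pose c (i : 'I_(size cs)) := tnth (in_tuple cs) i.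
have cE : map c (enum 'I_(size cs)) = cs by rewrite map_tnth_enum.
have l_gt0 i : 0 < (c i).1 by apply/cs_gt0/mem_tnth.
have sum_l : (\sum_i (c i).1)%N = n.
  by rewrite -sum_cs sumnE big_map [RHS]big_tnth.
exists (cycle_model (fun i => (c i).2) sum_l).
apply: perm_trans (cycle_data_model _ l_gt0 _) _.
rewrite (eq_map (g := c)) ?cE // => i.
by case: (c i).
Qed.

(** * Counting classes by their labels *)

Lemma p_orderP p (gT : finGroupType) (x : gT) : prime p ->
  reflect (exists a, #[x] = (p ^ a)%N) (p.-nat #[x]).
Proof.
move=> pr_p; apply: (iffP idP) => [/p_natP[a ->]|[a ->]]; first by exists a.
by rewrite pnatX pnat_id.
Qed.

Lemma ppow_label_surj p n (lm : seq nat * seq nat) : prime p ->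
  ppow_label p n lm ->
  exists2 w : signed_perm n, (exists a, #[w] = (p ^ a)%N) & cycle_types w = lm.
Proof.
move=> pr_p lm_ok; have [part1 part2 sum_lm _ _] := lm_ok.
set cs := [seq (l, false) | l <- lm.1] ++ [seq (l, true) | l <- lm.2].
have csE : types_of cs = lm := types_of_label part1 part2.
have [||w w_cs] := @cycle_data_surj n cs.
- move=> c; rewrite mem_cat => /orP[] /mapP[l l_lm ->] /=; rewrite lt0n.
    by apply: contraTneq l_lm => ->; case/andP: part1.
  by apply: contraTneq l_lm => ->; case/andP: part2.
- by rewrite -sumn_lengths_of -sum_lm -[in RHS]csE.
have wE : cycle_types w = lm.
  by rewrite cycle_typesE -csE; apply/types_of_perm.
by exists w => //; apply/ppow_order_label; rewrite ?wE.
Qed.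

Section ClassCounting.
Variables (gT : finGroupType) (G : {group gT}).

(** [ls] enumerates the values of a complete invariant of conjugacy on [P]; the
    class of any element with value [l] inverts it. *)
Lemma card_classes_by_label (K : eqType) (P : pred gT) (f : gT -> K) (ls : seq K) :
    uniq ls ->
    (forall l, l \in ls <-> exists2 x, x \in [predI G & P] & f x = l) ->
    {in [predI G & P] &, forall x y, x ^: G = y ^: G <-> f x = f y} ->
  #|[set x ^: G | x in G & P x]| = size ls.
Proof.
move=> uniq_ls lsP f_class.
pose cl l := odflt 1 [pick x in [predI G & P] | f x == l] ^: G.
have clP l : l \in ls -> exists2 x, x \in [predI G & P] & f x = l /\ cl l = x ^: G.
  move=> /lsP[x Px fx]; rewrite /cl; case: pickP => [y /andP[Py /eqP fy]|/(_ x)].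
    by exists y.
  by rewrite Px fx eqxx.
have cl_inj : {in ls &, injective cl}.
  move=> l m /clP[x Px [<- ->]] /clP[y Py [<- ->]].
  by move=> /(f_class _ _ Px Py).
rewrite -(size_map cl) -(card_uniqP _); last by rewrite map_inj_in_uniq.
apply: eq_card => C; apply/imsetP/mapP => [[x Px ->]|[l /clP[x Px [_ ->]] ->]].
  have Px' : x \in [predI G & P] by rewrite !inE in Px *.
  have fx_ls : f x \in ls by apply/lsP; exists x.
  exists (f x) => //; have [y Py [fy ->]] := clP _ fx_ls.
  by apply/f_class.
by exists x => //; rewrite !inE in Px *.
Qed.

(** The added unit in [r_tilde] counts the class of the identity, the only
    element of order [p ^ 0]. *)
Lemma r_tilde_classes p : prime p ->
  r_tilde p G = #|[set x ^: G | x in G & p.-nat #[x]]|.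
Proof.
move=> pr_p; rewrite /r_tilde /r.
have -> : [set x ^: G | x in G & p.-nat #[x]] =
    1 ^: G |: [set x ^: G | x in G & ppow_order p G x].
  apply/setP=> C; rewrite in_setU1; apply/imsetP/predU1P => [[x]|].
    rewrite inE => /andP[Gx /(p_orderP _ pr_p)[[|d] xd]] ->.
      by left; congr (_ ^: G); apply/eqP; rewrite -order_eq1 xd.
    right; apply/imsetP; exists x => //; rewrite inE Gx.
    by apply/ppow_orderP => //; exists d.+1.
  case=> [->|/imsetP[x]]; first by exists 1; rewrite // inE group1 order1.
  rewrite inE => /andP[Gx /(ppow_orderP pr_p Gx)[d _ xd]] ->.
  by exists x => //; rewrite inE Gx; apply/p_orderP => //; exists d.
rewrite cardsU1; suff -> : 1 ^: G \notin [set x ^: G | x in G & ppow_order p G x] by [].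
apply/imsetP=> -[x]; rewrite inE => /andP[Gx /(ppow_orderP pr_p Gx)[d d_gt0 xd]].
rewrite class1G => x1; have := class_refl G x; rewrite -x1 inE => /eqP xe.
by move: xd; rewrite xe order1 => /esym/eqP; rewrite -(expn0 p) eqn_exp2l
  ?prime_gt1 // eqn0Ngt d_gt0.
Qed.

End ClassCounting.

Lemma r_tilde_WB p n (labels : seq (seq nat * seq nat)) : prime p ->
  uniq labels -> (forall lm, lm \in labels <-> ppow_label p n lm) ->
  r_tilde p (WB n) = size labels.
Proof.
move=> pr_p uniq_labels labelsP; rewrite r_tilde_classes //.
apply: (card_classes_by_label (f := @cycle_types n)) => // [lm | u v _ _].
  split=> [/labelsP/(ppow_label_surj pr_p)[w pw <-]|[w /andP[_ pw] <-]].
    by exists w => //; rewrite !inE; apply/p_orderP.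
  by apply/labelsP/ppow_order_label => //; apply/p_orderP.
exact: class_cycle_types.
Qed.

(** * The symmetric group inside the signed permutations *)

Section Unsigned.
Variable n : nat.
Implicit Types s t : 'S_n.

Definition sp_unsigned s : signed_perm n := SignedPerm s [ffun=> false].

Lemma sp_unsignedM s t : sp_unsigned (s * t) = sp_unsigned s * sp_unsigned t.
Proof. by apply: signed_permP => i //=; rewrite !ffunE. Qed.

Lemma sp_unsignedX s k : sp_unsigned (s ^+ k) = sp_unsigned s ^+ k.
Proof. by elim: k => [|k IHk] //; rewrite !expgS sp_unsignedM IHk. Qed.

Lemma order_sp_unsigned s : #[sp_unsigned s] = #[s].
Proof.
apply/eqP; rewrite eqn_dvd !order_dvdn -sp_unsignedX expg_order eqxx /=.
apply/eqP; have := expg_order (sp_unsigned s).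
by rewrite -sp_unsignedX => /(congr1 (@sp_perm n)).
Qed.

(** Forgetting the signs of a conjugator in the larger group gives one in the
    symmetric group, as [sp_perm] is a morphism. *)
Lemma class_sp_unsigned s t :
  s ^: [set: 'S_n] = t ^: [set: 'S_n] <->
  sp_unsigned s ^: WB n = sp_unsigned t ^: WB n.
Proof.
split=> /class_eqP/imsetP[g _ st]; apply/class_eqP/imsetP.
  exists (sp_unsigned g); rewrite ?inE // st !conjgE !sp_unsignedM.
  congr (_ * _); apply: (mulgI (sp_unsigned g)).
  by rewrite -sp_unsignedM !mulgV.
exists (sp_perm g); rewrite ?inE //.
by have := congr1 (@sp_perm n) st.
Qed.

Lemma cycle_data_unsigned (w : signed_perm n) :
  cycle_data (sp_unsigned (sp_perm w)) = [seq (c.1, false) | c <- cycle_data w].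
Proof.
rewrite -map_comp; apply: eq_map => C /=; congr pair.
by rewrite /cycle_parity big1 // => i _; rewrite ffunE.
Qed.

(** An element without negative cycles has the same cycle type as its underlying
    permutation, even if some of its signs are negative; this is what makes
    every label without negative part come from the symmetric group. *)
Lemma cycle_types_unsigned (w : signed_perm n) l :
  cycle_types w = (l, [::]) -> cycle_types (sp_unsigned (sp_perm w)) = (l, [::]).
Proof.
move=> wl; rewrite cycle_typesE cycle_data_unsigned.
have pos c : c \in cycle_data w -> c.2 = false.
  case: c => k [] // kw; move: wl; rewrite cycle_typesE => -[_ neg].
  by move: kw; rewrite -mem_lengths_of neg.
suff -> : [seq (c.1, false) | c <- cycle_data w] = cycle_data w.
  by rewrite -cycle_typesE.
by rewrite -[RHS]map_id; apply/eq_in_map => -[k b] /pos/= ->.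
Qed.

Lemma cycle_types_unsigned2 s : (cycle_types (sp_unsigned s)).2 = [::].
Proof.
rewrite cycle_typesE -[s]/(sp_perm (sp_unsigned s)) cycle_data_unsigned /=.
by rewrite /lengths_of filter_map; elim: (cycle_data _).
Qed.

End Unsigned.

(** The partitions of [n] into powers of [p], see [ppow_partsP].  Listing them as
    cycle types of permutations makes their number a class count at once. *)
Definition ppow_parts p n : seq (seq nat) :=
  undup [seq (cycle_types (sp_unsigned s)).1 | s <- enum {: 'S_n} & p.-nat #[s]].

Lemma ppow_partsP p n l : prime p ->
  l \in ppow_parts p n <-> ppow_label p n (l, [::]).
Proof.
move=> pr_p; rewrite mem_undup; split.
  move=> /mapP[s]; rewrite mem_filter => /andP[ps _ ->].
  rewrite -(cycle_types_unsigned2 s) -surjective_pairing.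
  by apply/ppow_order_label => //; rewrite order_sp_unsigned; apply/p_orderP.
move=> ll; have [w pw wl] := ppow_label_surj pr_p ll.
have sl := cycle_types_unsigned wl.
apply/mapP; exists (sp_perm w); last by rewrite sl.
rewrite mem_filter mem_enum andbT; apply/p_orderP => //.
by rewrite -order_sp_unsigned; apply/ppow_order_label; rewrite ?sl.
Qed.

Lemma r_tilde_Sym p n : prime p -> r_tilde p [set: 'S_n] = size (ppow_parts p n).
Proof.
move=> pr_p; rewrite r_tilde_classes //.
apply: (card_classes_by_label (f := fun s => (cycle_types (sp_unsigned s)).1)).
- exact: undup_uniq.
- move=> l; rewrite mem_undup; split=> [/mapP[s]|[s /andP[_ ps] <-]].
    by rewrite mem_filter => /andP[ps _ ->]; exists s => //; rewrite !inE.
  by apply/mapP; exists s; rewrite // mem_filter mem_enum andbT.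
move=> s t _ _; apply: iff_trans (class_sp_unsigned _ _) _.
apply: iff_trans (class_cycle_types _ _) _; split=> [->//|st].
by rewrite [LHS]surjective_pairing [RHS]surjective_pairing st !cycle_types_unsigned2.
Qed.

(** * The counting formulas *)

Lemma r_tilde_WB_odd p n : prime p -> p <> 2 ->
  r_tilde p (WB n) = r_tilde p [set: 'S_n].
Proof.
move=> pr_p p_neq2; rewrite r_tilde_Sym //.
rewrite -(size_map (fun l => (l, [::] : seq nat))); apply: r_tilde_WB => //.
  by rewrite map_inj_uniq ?undup_uniq // => l m [].
move=> [l m]; split=> [/mapP[l' /(ppow_partsP _ _ pr_p) l'_ok [-> ->]] //|lm].
have m0 : m = [::] by case: lm => _ _ _ _; case: eqP.
by rewrite m0 in lm *; apply/map_f/ppow_partsP.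
Qed.

(** For [p = 2] the two lists of a label are constrained only by their total
    size [n], so the size [k] of the first one splits the labels. *)
Lemma ppow_label2 n l m :
  ppow_label 2 n (l, m) <->
  exists2 k, k <= n & l \in ppow_parts 2 k /\ m \in ppow_parts 2 (n - k).
Proof.
have single k x : x \in ppow_parts 2 k <->
    [/\ is_partition x, sumn x = k & parts_powers 2 x].
  apply: iff_trans (ppow_partsP _ _ _) _ => //; rewrite /ppow_label /= addn0.
  by split=> -[].
split=> [[/= part_l part_m sum_lm pow_l pow_m]|[k le_kn [/single[? sum_l ?]]]].
  exists (sumn l); first by rewrite -sum_lm leq_addr.
  by split; apply/single; split; rewrite // -sum_lm addKn.
by case/single=> ? sum_m ?; split; rewrite //= sum_l sum_m subnKC.
Qed.

Lemma r_tilde_WB2 n : r_tilde 2 (WB n) =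
  (\sum_(m < n.+1) r_tilde 2 [set: 'S_m] * r_tilde 2 [set: 'S_(n - m)])%N.
Proof.
pose pairs k := [seq (l, m) | l <- ppow_parts 2 k, m <- ppow_parts 2 (n - k)].
have pairs_sum k lm : lm \in pairs k -> sumn lm.1 = k.
  case/allpairsP=> -[l m] [/= l_k _ ->] /=.
  by move: l_k => /ppow_partsP-/(_ isT)[_ _ /=]; rewrite addn0.
rewrite (@r_tilde_WB 2 n [seq lm | k <- iota 0 n.+1, lm <- pairs k]) //.
- rewrite size_allpairs_dep sumnE big_map -[iota _ _]/(index_iota 0 n.+1).
  rewrite big_mkord; apply: eq_bigr => k _.
  by rewrite size_allpairs !r_tilde_Sym.
- apply: allpairs_uniq_dep; first exact: iota_uniq.
    move=> k _; apply: allpairs_uniq; rewrite ?undup_uniq //.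
    by move=> [l m] [l' m'] _ _ [-> ->].
  move=> _ _ /allpairsPdep[k [lm [_ lm_k ->]]] /allpairsPdep[k' [lm' [_ lm'_k ->]]].
  move=> /= lmE; move: lm'_k; rewrite -lmE => lm'_k.
  by rewrite -(pairs_sum _ _ lm_k) -(pairs_sum _ _ lm'_k).
move=> [l m]; apply: iff_trans _ (iff_sym (ppow_label2 _ _ _)).
split=> [/allpairsPdep[k [_ [k_n /allpairsP[[l' m'] [/= ? ? ->]] [-> ->]]]]|].
  by exists k => //; rewrite mem_iota in k_n.
move=> [k k_n [l_k m_k]]; apply/allpairsPdep; exists k, (l, m).
by split; rewrite // ?mem_iota //; apply/allpairsP; exists (l, m).
Qed.

Theorem proposition4p5 (p : nat) (p_prime : prime p) :
  [/\ (* cycle_types labels the classes of elements of order p^r, r >= 0 *)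
      forall n : nat,
        [/\ forall w : signed_perm n, w \in WB n ->
              (exists a : nat, #[w] = (p ^ a)%N) <-> ppow_label p n (cycle_types w),
            forall u v : signed_perm n, u \in WB n -> v \in WB n ->
              (exists a : nat, #[u] = (p ^ a)%N) ->
              (exists a : nat, #[v] = (p ^ a)%N) ->
              u ^: WB n = v ^: WB n <-> cycle_types u = cycle_types v
          & forall lm : seq nat * seq nat, ppow_label p n lm ->
              exists2 w : signed_perm n, w \in WB n &
                (exists a : nat, #[w] = (p ^ a)%N) /\ cycle_types w = lm],
      forall n : nat,
        r_tilde 2 (WB n) =
        (\sum_(m < n.+1) r_tilde 2 [set: 'S_m] * r_tilde 2 [set: 'S_(n - m)])%N,
      p <> 2 -> forall n : nat, r_tilde p (WB n) = r_tilde p [set: 'S_n],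
      OGFt_B 2 =1 fps_mul (OGFt_A 2) (OGFt_A 2)
    & p <> 2 -> OGF_B p =1 OGF_A p].
Proof.
split.
- move=> n; split=> [w _|u v _ _ _ _|lm lm_ok].
  + exact: ppow_order_label.
  + exact: class_cycle_types.
  + by have [w pw wE] := ppow_label_surj p_prime lm_ok; exists w; rewrite ?inE.
- exact: r_tilde_WB2.
- by move=> p_neq2 n; apply: r_tilde_WB_odd.
- move=> n; rewrite /OGFt_B r_tilde_WB2 /fps_mul /OGFt_A.
  rewrite -natz GRing.natr_sum; apply: eq_bigr => m _.
  by rewrite GRing.natrM !natz.
move=> p_neq2 n; rewrite /OGF_B /OGF_A; congr Posz.
by apply: succn_inj; apply: r_tilde_WB_odd.
Qed.
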